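(* Let $n\ge2$. Any $n$-player atomic splittable congestion game all of whose resource cost functions belong to $Q_n(\mathbb R_+)\cap\mathcal D_{\mathrm{mc\text{-}si}}(\mathbb R_+)$ has a unique Nash equilibrium.
   Context: Cost classes. $\mathbb R_+=[0,\infty)$. $\mathcal D(\mathbb R_+)$ is the set of $f\in C^2(\mathbb R_+)$ (real-valued) with $f'(x)\ge0$ and $2f'(x)+xf''(x)\ge0$ for all $x\in\mathbb R_+$. For $n\ge2$, $\gamma_n:=\frac{2(n+1)}{n-1}$ and $Q_n(\mathbb R_+):=\{f\in\mathcal D(\mathbb R_+):\gamma_nf'(x)-xf''(x)\ge0\ \forall x\in\mathbb R_+\}$. $\mathcal D_{\mathrm{mc\text{-}si}}(\mathbb R_+)$ is the set of $f\in\mathcal D(\mathbb R_+)$ such that $x\mapsto f(x)+xf'(x)$ is strictly increasing on every non-degenerate interval (one with endpoints $a<b$ in $\mathbb R_+$). Games. An $n$-player atomic splittable congestion game is a tuple $(N,E,(K_i)_{i\in N},(c_e)_{e\in E})$ with $N=\{1,\dots,n\}$, a finite resource set $E$, nonempty convex compact strategy sets $K_i\subset\mathbb R_+^E$, and cost functions $c_e\in\mathcal D(\mathbb R_+)$. Put $K:=\prod_iK_i$ and $\bar x_e:=\sum_{i\in N}x_{i,e}$ for $x\in K$. Player $i$'s private cost is $\pi_i(x)=\sum_{e\in E}c_e(\bar x_e)x_{i,e}$; $x\in K$ is a Nash equilibrium if $\pi_i(x)\le\pi_i(y_i,x_{-i})$ for all $i\in N$ and $y_i\in K_i$. *)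

(* Defs.v *)
From HB Require Import structures.
From mathcomp Require Import all_boot all_order all_algebra.
From mathcomp Require Import all_classical all_reals all_analysis.
Set Implicit Arguments.
Unset Strict Implicit.
Unset Printing Implicit Defensive.
Import Order.TTheory GRing.Theory Num.Theory.
Import numFieldNormedType.Exports.
Local Open Scope classical_set_scope.
Local Open Scope ring_scope.

Section CostClasses.
Variable R : realType.
Implicit Types (f : R -> R) (x : R).

Definition Rplus : set R := [set x | 0 <= x].

(* A function on Rplus is a total f : R -> R of which only the restriction to
   Rplus matters. Derivatives are relative to Rplus (the difference quotient is
   evaluated only at points y of Rplus), hence one-sided at 0. *)
Definition diffquot_Rplus f x : set_system R :=
  (fun y => (f y - f x) / (y - x)) @ within Rplus x^'.

Definition derivable_Rplus f x : Prop := cvg (diffquot_Rplus f x).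

(* Unspecified when f is not derivable at x. *)
Definition deriv_Rplus f x : R := lim (diffquot_Rplus f x).

Definition deriv2_Rplus f : R -> R := deriv_Rplus (deriv_Rplus f).

Definition C2_Rplus f : Prop :=
  [/\ forall x, 0 <= x -> derivable_Rplus f x,
      forall x, 0 <= x -> derivable_Rplus (deriv_Rplus f) x
    & {within Rplus, continuous deriv2_Rplus f}].

Definition classD f : Prop :=
  [/\ C2_Rplus f,
      forall x, 0 <= x -> 0 <= deriv_Rplus f x
    & forall x, 0 <= x -> 0 <= 2 * deriv_Rplus f x + x * deriv2_Rplus f x].

Definition gamma (n : nat) : R := 2 * (n%:R + 1) / (n%:R - 1).

Definition classQ (n : nat) f : Prop :=
  classD f /\ forall x, 0 <= x -> 0 <= gamma n * deriv_Rplus f x - x * deriv2_Rplus f x.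

(* s and t range over the four kinds (open, half-open, closed) of intervals
   with endpoints a < b. *)
Definition classDmcsi f : Prop :=
  classD f /\
  forall (a b : R) (s t : bool), 0 <= a -> a < b ->
    {in Interval (BSide s a) (BSide t b) &,
      {homo (fun x => f x + x * deriv_Rplus f x) : x y / x < y}}.

End CostClasses.

(* {ptws E -> R} is E -> R with the product topology, which for the finite
   type E is the Euclidean topology of R^E. *)
Record splittable_game (R : realType) (n : nat) (E : finType) := SplittableGame {
  strategies : 'I_n -> set (E -> R);
  cost : E -> R -> R;
  strategies_nonempty : forall i, strategies i !=set0;
  strategies_ge0 : forall i s, strategies i s -> forall e, 0 <= s e;
  strategies_convex : forall i, convex_set (strategies i);
  strategies_compact : forall i, @compact {ptws E -> R} (strategies i);
  cost_classD : forall e, classD (cost e) }.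

Section Equilibrium.
Variables (R : realType) (n : nat) (E : finType) (G : splittable_game R n E).
Implicit Types (x : 'I_n -> E -> R) (i : 'I_n).

Definition profiles : set ('I_n -> E -> R) :=
  [set x | forall i, strategies G i (x i)].

Definition load x (e : E) : R := \sum_(i < n) x i e.

Definition private_cost i x : R := \sum_(e : E) cost G e (load x e) * x i e.

Definition is_nash x : Prop :=
  profiles x /\
  forall i (y : E -> R), strategies G i y ->
    private_cost i x <= private_cost i [eta x with i |-> y].

End Equilibrium.

(* Main.v *)
Require Import Defs.
From mathcomp Require Import all_boot all_order all_algebra finmap.
From mathcomp Require Import all_classical all_reals all_analysis.
From mathcomp Require Import ring lra.

Set Implicit Arguments.
Unset Strict Implicit.
Unset Printing Implicit Defensive.
Import Order.TTheory GRing.Theory Num.Theory.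
Import numFieldNormedType.Exports.
Local Open Scope classical_set_scope.
Local Open Scope ring_scope.

(** The idea is that the first-order conditions of all players form a monotone
variational inequality, and that monotonicity gives both halves of the claim.

Write F x for the pseudogradient of a profile x: its (i, e) entry is the
marginal cost c_e(X) + x_(i,e) c_e'(X) of player i on the resource e, where X is
the load of e.  On one resource, the Jacobian of F in a direction v of sum s is
the quadratic form c'(X) (s^2 + |v|^2) + s c''(X) sum_i x_i v_i.  It is affine
in x, hence an average of its values at the vertices of the simplex of load X;
at the vertex of player i, Cauchy-Schwarz leaves a form in s and v_i that is
nonnegative exactly when X c''(X) lies between -2 c'(X), which is the second
condition of the class D, and gamma_n c'(X), which is the condition of Q_n
([vertex_form_ge0]).  So F is monotone ([marginal_monotone]).

Restricted to a move of a single player, monotonicity says that every private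
cost is convex in the own strategy.  Nash equilibria are therefore the
solutions x of <F x, z - x> >= 0 for all profiles z ([is_nashP]).

Existence comes from monotonicity and compactness rather than from a fixed
point theorem: there is x with <F y, y - x> >= 0 for all y
([minty_inequality]); taking y on the segment from x to z and letting y tend to
x gives <F x, z - x> >= 0.

For uniqueness, two equilibria x and y satisfy <F x - F y, x - y> <= 0, so the
monotonicity inequality is an equality on each resource.  By the mean value
theorem the Jacobian form vanishes at one interior point of the segment from y
to x, and the equality case ([jacobian_form_eq0]) says that either x and y
agree on this resource or a single player uses it.  In the latter case F is
the one-variable function X |-> c(X) + X c'(X), which is strictly increasing,
so that x and y agree as well ([marginal_strict]). *)

(** * Limits along a ray *)

Lemma continuous_ge0_at0 (R : realType) (f : R -> R) : continuous f ->
  (forall t, 0 < t <= 1 -> 0 <= f t) -> 0 <= f 0.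
Proof.
move=> cf f_ge0; have f_right : f t @[t --> 0^'+] --> f 0.
  exact/cvg_at_right_filter/cf.
rewrite -(cvg_lim _ f_right) //; apply: limr_ge; first by apply/cvg_ex; exists (f 0).
near=> t; apply: f_ge0; apply/andP; split; near: t.
  exact: nbhs_right_gt.
exact: nbhs_right_le.
Unshelve. all: by end_near. Qed.

Lemma continuous_affine (R : realType) (p q : R) :
  continuous (fun t : R => p + t * q : R).
Proof.
move=> t; apply: cvgD; first exact: cvg_cst.
by apply: cvgM; [exact: cvg_id|exact: cvg_cst].
Qed.

(** * Monotone variational inequalities on compact sets *)

(** The square of the positive part has a derivative, 2 max(0, p), of Lipschitz
constant 2: this is the resulting quadratic bound at p. *)
Lemma sqr_pos_partD (R : realType) (p d : R) :
  Num.max 0 (p + d) ^+ 2 <= Num.max 0 p ^+ 2 + 2 * d * Num.max 0 p + d ^+ 2.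
Proof. by case: (leP 0 (p + d)) => ?; case: (leP 0 p) => ?; nra. Qed.

(** Here b y x stands for <F y, y - x> with F monotone.  Only three features of
this pairing are used: it is affine along segments of K in x, the sum
b x y + b y x = <F x - F y, x - y> is nonnegative, and it is continuous in x. *)
Section MonotoneInequality.
Variables (R : realType) (T : topologicalType) (K : set T) (b : T -> T -> R).
Hypothesis K_compact : compact K.
Hypothesis K_nonempty : K !=set0.
Hypothesis b_continuous : forall y, continuous (b y : T -> R).
Hypothesis b_affine : forall x z (t : R), K x -> K z -> 0 < t <= 1 ->
  exists2 w, K w & forall y, b y w = b y x + t * (b y z - b y x).
Hypothesis b_monotone : forall x y, K x -> K y -> 0 <= b x y + b y x.

(** Minimise the total squared violation Phi of the finitely many inequalities
over K.  At a minimiser x with violations u_y, moving toward a point k of s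
cannot decrease Phi, whence sum_y u_y b y k <= - Phi x.  After summation over k
with the weights u_k, the left side is nonnegative by monotonicity, so that
0 <= - Phi x * sum_k u_k and no inequality is violated. *)
Lemma minty_finite (s : seq T) : {in s, forall y, K y} ->
  exists2 x, K x & {in s, forall y, 0 <= b y x}.
Proof.
move=> sK; pose u x y := Num.max 0 (- b y x).
pose Phi x := \sum_(y <- s) u x y ^+ 2.
have u0 x y : 0 <= u x y by rewrite le_max lexx.
have Phi_cont : continuous (Phi : T -> R).
  apply: continuous_big => [|y _ x]; first exact: add_continuous.
  have cu_y : {for x, continuous (fun x => u x y : R^o)}.
    apply: continuous_max; first exact: cvg_cst.
    by apply: continuousN; exact: b_continuous.
  exact: (continuousM cu_y cu_y).
have [x /set_mem Kx x_min] :=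
  compact_EVT_min K_nonempty K_compact (continuous_subspaceT Phi_cont).
exists x => //.
(* first-order optimality of x in the direction of k *)
have key k : k \in s -> \sum_(y <- s) u x y * b y k <= - Phi x.
  move=> ks; pose d y := b y x - b y k.
  suff : 0 <= 2 * \sum_(y <- s) d y * u x y.
    have -> : \sum_(y <- s) d y * u x y
        = - Phi x - \sum_(y <- s) u x y * b y k.
      rewrite /Phi -sumrN -sumrB; apply: eq_bigr => y _.
      by rewrite /d /u; case: (leP 0 (- b y x)) => _; ring.
    lra.
  set g := (X in 0 <= X); pose q := \sum_(y <- s) d y ^+ 2.
  rewrite (_ : g = g + 0 * q); last by rewrite mul0r addr0.
  apply: (@continuous_ge0_at0 _ (fun t => g + t * q)) => [|t t01].
    exact: continuous_affine.
  have [w Kw bw] := b_affine Kx (sK k ks) t01.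
  have /andP[t0 _] := t01.
  have := x_min w (mem_set Kw).
  have : Phi w <= Phi x + t * g + t ^+ 2 * q.
    rewrite /Phi /g /q !mulr_sumr -!big_split /=; apply: ler_sum => y _.
    have -> : u w y = Num.max 0 (- b y x + t * d y).
      by rewrite /u bw /d; congr Num.max; ring.
    apply: le_trans (sqr_pos_partD _ _) _.
    by rewrite -/(u x y) le_eqVlt; apply/orP; left; apply/eqP; ring.
  move=> h1 h2.
  rewrite -(ler_pM2l t0); nra.
pose S := \sum_(k <- s) \sum_(y <- s) u x k * u x y * b y k.
have S_ge0 : 0 <= S.
  suff : 0 <= S + S by lra.
  rewrite {2}/S exchange_big /= -big_split /=.
  rewrite big_seq; apply: sumr_ge0 => k ks; rewrite -big_split /=.
  rewrite big_seq; apply: sumr_ge0 => y ys.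
  have -> : u x k * u x y * b y k + u x y * u x k * b k y
      = u x k * u x y * (b y k + b k y) by ring.
  by rewrite !mulr_ge0 // b_monotone //; exact: sK.
have S_le : S <= - Phi x * \sum_(k <- s) u x k.
  rewrite mulr_sumr /S big_seq [leRHS]big_seq; apply: ler_sum => k ks.
  rewrite [leRHS]mulrC; under eq_bigr do rewrite -mulrA.
  by rewrite -mulr_sumr ler_wpM2l // key.
move=> y ys; rewrite leNgt; apply/negP => by0.
have uy0 : 0 < u x y by rewrite lt_max oppr_gt0 by0 orbT.
have Phi_gt0 : 0 < Phi x.
  rewrite /Phi (big_rem y) //= ltr_wpDr ?exprn_gt0 //.
  by apply: sumr_ge0 => z _; rewrite exprn_ge0.
have sum_gt0 : 0 < \sum_(k <- s) u x k.
  by rewrite (big_rem y) //= ltr_wpDr // sumr_ge0.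
nra.
Qed.

(** The sets of the x with 0 <= b y x are closed, and [minty_finite] is their
finite intersection property. *)
Theorem minty_inequality : exists2 x, K x & forall y, K y -> 0 <= b y x.
Proof.
pose above y := [set x | 0 <= b y x].
have above_finI : finI K (fun y => K `&` above y).
  move=> D DK; have DK' : {in enum_fset D, forall y, K y}.
    by move=> y yD; exact: set_mem (DK y yD).
  by have [x Kx bx] := minty_finite DK'; exists x => y yD; split; [|exact: bx].
have F_proper := finI_filter above_finI.
pose F := filter_from (finI_from K (fun y => K `&` above y)) id.
have F_above y : K y -> F (K `&` above y).
  by move=> Ky; exists (K `&` above y) => //; exact: finI_from1.
have [y0 Ky0] := K_nonempty.
have [x [Kx clx]] : K `&` cluster F !=set0.
  by apply: K_compact; apply: filterS (F_above _ Ky0) => x [].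
exists x => // y Ky; suff : above y x by [].
have above_closed : closed (above y).
  apply: (@preimage_closed _ _ (b y) [set r | 0 <= r]); last exact: closed_ge.
  by move=> z _; exact: b_continuous.
apply: above_closed => B xB; apply: clx => //.
by apply: filterS (F_above _ Ky) => z [].
Qed.

End MonotoneInequality.

(** * Functions differentiable on the half-line *)

Section OneSidedDerivative.
Variable R : realType.
Implicit Types (f : R -> R) (x : R).

(** Carathéodory's form of the relative derivative: the slope is completed at x,
so that limits of f near x no longer exclude x itself. *)
Lemma caratheodory_Rplus f x : derivable_Rplus f x ->
  exists g : R -> R, [/\ forall z, f z - f x = g z * (z - x),
    g @ within (@Rplus R) (nbhs x) --> g x & g x = deriv_Rplus f x].
Proof.
move=> df; pose q y := (f y - f x) / (y - x).
exists (fun z => if z == x then deriv_Rplus f x else q z); split; last by rewrite eqxx.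
- move=> z; case: eqVneq => [->|zx]; first by rewrite !subrr mulr0.
  by rewrite /q mulfVK // subr_eq0.
- rewrite eqxx => U Ul.
  have qU : \forall y \near x, y != x -> Rplus y -> U (q y).
    exact: (df U Ul).
  suff : \forall y \near x, Rplus y ->
      U (if y == x then deriv_Rplus f x else q y) by [].
  apply: filterS qU => y yU y0.
  by case: eqVneq => yx; [exact: nbhs_singleton Ul|exact: yU].
Qed.

Lemma is_derive_Rplus f x : 0 < x -> derivable_Rplus f x ->
  is_derive x (1 : R) f (deriv_Rplus f x).
Proof.
move=> x0 /caratheodory_Rplus[g [fg gx <-]]; apply/is_derive1_caratheodory.
exists g; split => // U Ul.
have gU : \forall y \near x, Rplus y -> U (g y) := gx U Ul.
suff : \forall y \near x, U (g y) by [].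
by near=> y; apply: (near gU y) => //; apply/ltW; near: y; exact: lt_nbhsr.
Unshelve. all: by end_near. Qed.

(** Extending f to the left of 0 by the constant f 0 turns relative continuity
on the half-line into continuity on R; the extension is in general not
differentiable at 0, which is harmless as the mean value theorem asks for
derivatives at interior points only. *)
Definition clamp f : R -> R := fun y => f (Num.max 0 y).

Lemma clampE f x : 0 <= x -> clamp f x = f x.
Proof. by rewrite /clamp => /max_idPr ->. Qed.

Lemma clamp_continuous f : (forall x, 0 <= x -> derivable_Rplus f x) ->
  continuous (clamp f).
Proof.
move=> df y; set x := Num.max 0 y.
have max_ge0 z : 0 <= Num.max 0 z :> R by rewrite le_max lexx.
have [g [fg gx _]] := caratheodory_Rplus (df x (max_ge0 y)).
have max_x : Num.max 0 z @[z --> y] --> within (@Rplus R) (nbhs x).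
  move=> U xU.
  have max_y : {for y, continuous (fun z : R => Num.max 0 z : R^o)}.
    by apply: continuous_max; [exact: cvg_cst|exact: cvg_id].
  have xU' : \forall z \near x, Rplus z -> U z := xU.
  suff : \forall z \near y, U (Num.max 0 z) by [].
  have yU : \forall z \near y, Rplus (Num.max 0 z) -> U (Num.max 0 z) :=
    max_y _ xU'.
  by apply: filterS yU => z; apply; exact: max_ge0.
suff : f z @[z --> within (@Rplus R) (nbhs x)] --> f x by exact: cvg_comp max_x.
have -> : f = (fun z => f x + g z * (z - x)).
  by apply/funext => z; rewrite -fg addrC subrK.
rewrite -[X in _ --> X](addr0 _).
rewrite [X in _ --> X](_ : _ = f x + g x * (x - x)); last first.
  by rewrite subrr mulr0 !addr0.
apply: cvgD; first exact: cvg_cst.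
apply: cvgM => //; apply: cvgB; last exact: cvg_cst.
exact: cvg_within.
Qed.

Lemma clamp_affine_continuous f (p q : R) :
  (forall x, 0 <= x -> derivable_Rplus f x) ->
  continuous (fun t : R => clamp f (p + t * q)).
Proof.
move=> df t; apply: continuous_comp; first exact: continuous_affine.
exact: clamp_continuous.
Qed.

Lemma is_derive_clamp f x : 0 < x -> derivable_Rplus f x ->
  is_derive x (1 : R) (clamp f) (deriv_Rplus f x).
Proof.
move=> x0 /(is_derive_Rplus x0); apply: near_eq_is_derive; rewrite ?oner_neq0 //.
by near=> y; rewrite clampE //; apply/ltW; near: y; exact: lt_nbhsr.
Unshelve. all: by end_near. Qed.

(** The mean value theorem on [0, 1] for the function
t |-> a f1(Y + t s) + (A + t B) f2(Y + t s).  Along a segment of strategy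
vectors, the load is Y + t s and both the marginal costs (paired with a fixed
direction) and the private costs have this shape.  The argument Y + t s is
positive for 0 < t < 1 even when it starts or ends at 0. *)
Lemma line_mvt f1 f2 (Y s a A B : R) :
  (forall x, 0 <= x -> derivable_Rplus f1 x) ->
  (forall x, 0 <= x -> derivable_Rplus f2 x) ->
  0 <= Y -> 0 <= Y + s -> 0 < Y + (Y + s) ->
  exists t, [/\ 0 < t < 1, 0 < Y + t * s &
    a * f1 (Y + s) + (A + B) * f2 (Y + s) - (a * f1 Y + A * f2 Y)
    = a * s * deriv_Rplus f1 (Y + t * s) + B * f2 (Y + t * s)
      + (A + t * B) * s * deriv_Rplus f2 (Y + t * s)].
Proof.
move=> df1 df2 Y0 Ys0 pos.
have X_gt0 (t : R) : 0 < t < 1 -> 0 < Y + t * s.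
  move=> /andP[t0 t1]; have -> : Y + t * s = (1 - t) * Y + t * (Y + s) by ring.
  have [Y_gt0|Y_le0] := ltP 0 Y.
    by rewrite ltr_pwDl // ?mulr_gt0 ?mulr_ge0 ?subr_gt0 // ltW.
  by rewrite ltr_wpDl // ?mulr_gt0 ?mulr_ge0 ?subr_ge0 ?(ltW t1) //; lra.
pose X t : R := Y + t * s; pose L t : R := A + t * B.
pose g t := a * clamp f1 (X t) + L t * clamp f2 (X t).
pose g' t := a * s * deriv_Rplus f1 (X t) + B * f2 (X t)
  + L t * s * deriv_Rplus f2 (X t).
have X_cont f : (forall x, 0 <= x -> derivable_Rplus f x) ->
    continuous (fun t => clamp f (X t)).
  by move=> df; exact: clamp_affine_continuous.
have affine_derive p q (t : R) : is_derive t (1 : R) (fun t : R => p + t * q : R) q.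
  rewrite (_ : (fun _ => _) = cst p + q *: id); last first.
    by apply/funext => u; rewrite mulrC.
  have := is_deriveD (is_derive_cst p t 1) (is_deriveZ q (is_derive_id t 1)).
  by rewrite add0r /GRing.scale /= mulr1.
have g_derive (t : R) : t \in `]0, 1[ -> is_derive t (1 : R) g (g' t).
  rewrite in_itv /= => t01.
  have comp_derive f : (forall x, 0 <= x -> derivable_Rplus f x) ->
      is_derive t (1 : R) (clamp f \o X) (deriv_Rplus f (X t) * s).
    move=> df; apply: is_derive1_comp; apply: is_derive_clamp (X_gt0 _ t01) _.
    exact/df/ltW/X_gt0.
  have d1 := comp_derive _ df1; have d2 := comp_derive _ df2.
  have dL := affine_derive A B t.
  rewrite (_ : g = (a *: (clamp f1 \o X)) + L * (clamp f2 \o X)); last by [].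
  apply: is_derive_eq (is_deriveD (is_deriveZ a d1) (is_deriveM dL d2)) _.
  rewrite /g' /L /GRing.scale /= clampE; last exact/ltW/X_gt0.
  ring.
have g_cont : {within `[0, 1], continuous g}.
  apply: continuous_subspaceT => t; apply: cvgD.
    by apply: cvgM; [exact: cvg_cst|exact: X_cont].
  by apply: cvgM; [exact: continuous_affine|exact: X_cont].
have [t t01 gE] := MVT ltr01 g_derive g_cont.
rewrite in_itv /= in t01; exists t; split; [by []|exact: X_gt0|].
move: gE; rewrite /g /g' /X /L !mul0r !mul1r !addr0 !clampE // => ->; ring.
Qed.

End OneSidedDerivative.

(** * The Jacobian form of one resource *)

Section QuadraticForm.
Variables (R : realType) (n : nat).
Hypothesis n_ge2 : (2 <= n)%N.
Implicit Types (v p : 'I_n -> R) (d r : R).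

(** Cauchy-Schwarz against the constant vector on the n - 1 other players. *)
Lemma sqr_sum_other_le v i :
  (\sum_(j | j != i) v j) ^+ 2 <= (n%:R - 1) * \sum_(j | j != i) v j ^+ 2.
Proof.
set m : R := n%:R - 1.
have m_gt0 : 0 < m by rewrite subr_gt0 ltr1n.
have sum1 : \sum_(j | j != i) (1 : R) = m.
  by rewrite sumr_const cardC1 card_ord /m -subn1 natrB // ltnW.
have expand S : \sum_(j | j != i) (m * v j - S) ^+ 2
    = m ^+ 2 * (\sum_(j | j != i) v j ^+ 2)
      - 2 * m * S * (\sum_(j | j != i) v j) + S ^+ 2 * m.
  rewrite -{4}sum1 !mulr_sumr -sumrB -big_split /=.
  by apply: eq_bigr => j _; ring.
have := expand (\sum_(j | j != i) v j).
set S := \sum_(j | _) v j; set Q := \sum_(j | _) v j ^+ 2 => {}expand.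
have : 0 <= \sum_(j | j != i) (m * v j - S) ^+ 2.
  by apply: sumr_ge0 => j _; rewrite sqr_ge0.
rewrite expand => h; have : 0 <= m * (m * Q - S ^+ 2) by nra.
by rewrite pmulr_rge0 // subr_ge0.
Qed.

Definition jacobian_form v p d D : R :=
  d * ((\sum_j v j) ^+ 2 + \sum_j v j ^+ 2)
  + (\sum_j v j) * D * \sum_j p j * v j.

(** The Jacobian form when player i owns the whole load X, with r = X c''(X). *)
Definition vertex_form v d r i : R :=
  d * ((\sum_j v j) ^+ 2 + \sum_j v j ^+ 2) + r * (\sum_j v j) * v i.

(** Put m = n - 1, a = v i and s = \sum_j v j.  By Cauchy-Schwarz the other
players contribute at least (s - a)^2 / m to the sum of squares, so that m times
the form is at least d ((m + 1) (s^2 + a^2) - 2 s a) + m r s a.  This is affine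
in r; at the end r = - 2 d it is the square d (m + 1) (s - a)^2, and at the end
r = gamma n * d = 2 (m + 2) / m * d it is the square d (m + 1) (s + a)^2. *)
Lemma vertex_form_ge0 v i d r :
  0 <= d -> 0 <= 2 * d + r -> 0 <= gamma R n * d - r -> 0 <= vertex_form v d r i.
Proof.
move=> d0 r_lo; have CS := sqr_sum_other_le v i; rewrite /gamma /vertex_form.
rewrite (bigD1 i) //= [\sum_j v j ^+ 2](bigD1 i) //=.
move: CS; set S := \sum_(j | _) v j; set Q := \sum_(j | _) _ ^+ 2.
set a := v i; set s := a + S.
have m_gt0 : 0 < n%:R - 1 :> R by rewrite subr_gt0 ltr1n.
rewrite (_ : n%:R + 1 = (n%:R - 1) + 2); last ring.
move: (n%:R - 1) m_gt0 => m m_gt0 CS r_hi.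
have {}r_hi : 0 <= 2 * (m + 2) * d - m * r.
  have -> : 2 * (m + 2) * d - m * r = m * (2 * (m + 2) / m * d - r).
    by field; rewrite gt_eqF.
  by rewrite mulr_ge0 // ltW.
rewrite -(pmulr_rge0 _ m_gt0).
have dCS : 0 <= d * (m * Q - S ^+ 2) by rewrite mulr_ge0 // subr_ge0.
have SE : S = s - a by rewrite /s; ring.
suff : 0 <= d * ((m + 1) * (s ^+ 2 + a ^+ 2) - 2 * (s * a)) + m * r * (s * a).
  by move: dCS; rewrite SE; nra.
have [sa0|sa0] := leP 0 (s * a).
  have h1 : 0 <= m * (2 * d + r) * (s * a) by rewrite mulr_ge0 // mulr_ge0 // ltW.
  have h2 : 0 <= d * ((m + 1) * (s - a) ^+ 2).
    by rewrite mulr_ge0 // mulr_ge0 ?sqr_ge0 // addr_ge0 // ltW.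
  nra.
have h1 : 0 <= (2 * (m + 2) * d - m * r) * - (s * a).
  by rewrite mulr_ge0 // oppr_ge0 ltW.
have h2 : 0 <= d * ((m + 1) * (s + a) ^+ 2).
  by rewrite mulr_ge0 // mulr_ge0 ?sqr_ge0 // addr_ge0 // ltW.
nra.
Qed.

Section JacobianForm.
Variables (v p : 'I_n -> R) (d D : R).
Local Notation P := (\sum_j p j).
Hypotheses (p_ge0 : forall j, 0 <= p j) (P_gt0 : 0 < P).
Hypothesis d_ge0 : 0 <= d.
Hypotheses (lo : 0 <= 2 * d + P * D) (hi : 0 <= gamma R n * d - P * D).

Lemma jacobian_form_average :
  P * jacobian_form v p d D = \sum_i p i * vertex_form v d (P * D) i.
Proof.
rewrite /vertex_form; under [RHS]eq_bigr do rewrite mulrDr.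
rewrite big_split /= -mulr_suml /jacobian_form mulrDr; congr (_ + _).
rewrite mulrA mulr_sumr; apply: eq_bigr => i _; ring.
Qed.

Lemma jacobian_form_ge0 : 0 <= jacobian_form v p d D.
Proof.
rewrite -(pmulr_rge0 _ P_gt0) jacobian_form_average; apply: sumr_ge0 => i _.
by rewrite mulr_ge0 // vertex_form_ge0.
Qed.

(** Let v != 0.  The vertex form of every player i with p i > 0 vanishes, which
determines s (v i), so that all these players have the same v i = a, and the
others have v i = 0.  Then |v|^2 = s a, and the vertex form becomes
s (d (s + a) + P D a).  With P D >= - 2 d this forces s a <= a^2, i.e.
|v|^2 <= a^2: only player i moves, and any other player with p j > 0 would move
too. *)
Lemma jacobian_form_eq0 : 0 < d -> (forall j, p j = 0 -> v j = 0) ->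
  jacobian_form v p d D = 0 ->
  (forall j, v j = 0) \/ exists i, forall j, j != i -> p j = 0.
Proof.
move=> d_gt0 v_supp form0; set s := \sum_j v j; set Q := \sum_j v j ^+ 2.
have vertex0 i : 0 < p i -> vertex_form v d (P * D) i = 0.
  move=> pi; have := jacobian_form_average; rewrite form0 mulr0 => /esym/eqP.
  rewrite psumr_eq0 => [|j _]; last by rewrite mulr_ge0 // vertex_form_ge0.
  move=> /allP /(_ i (mem_index_enum _)) /=.
  by rewrite mulf_eq0 gt_eqF //= => /eqP.
have Q_ge0 : 0 <= Q by apply: sumr_ge0 => j _; rewrite sqr_ge0.
have v0_of_Q : Q <= 0 -> forall j, v j = 0.
  move=> Q0 j; have /eqP : Q = 0 by apply/eqP; rewrite eq_le Q0.
  rewrite psumr_eq0 => [|k _]; last by rewrite sqr_ge0.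
  by move=> /allP /(_ j (mem_index_enum _)) /=; rewrite expf_eq0 => /eqP.
have [Q_le0|Q_gt0] := leP Q 0; first by left; exact: v0_of_Q.
have [i pi] : exists i, 0 < p i.
  apply/existsP; rewrite -[X in is_true X]negbK negb_exists; apply/negP => /forallP h.
  suff : P <= 0 by rewrite leNgt P_gt0.
  by apply: sumr_le0 => j _; rewrite leNgt.
right; exists i.
have bi := vertex0 i pi; rewrite /vertex_form -/s -/Q in bi.
have v_eq j : 0 < p j -> v j = v i.
  move=> pj; have bj := vertex0 j pj; rewrite /vertex_form -/s -/Q in bj.
  have : P * D * s * (v j - v i) = 0 by lra.
  move=> /eqP; rewrite mulf_eq0 => /orP[/eqP z|]; last by rewrite subr_eq0 => /eqP.
  exfalso; move: bi; rewrite z mul0r addr0 => /eqP; rewrite gt_eqF //.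
  by rewrite mulr_gt0 // ltr_wpDl // sqr_ge0.
have QE : Q = s * v i.
  rewrite /Q /s mulr_suml; apply: eq_bigr => j _.
  have [pj|/v_eq ->//] := leP (p j) 0; rewrite v_supp ?mulr0 ?mul0r ?expr0n //.
  by apply/eqP; rewrite eq_le pj p_ge0.
have s_v : 0 < s * v i by rewrite -QE.
have s_le : s * v i <= v i ^+ 2.
  have s0 : s != 0 by apply: contraTneq s_v => ->; rewrite mul0r ltxx.
  have h : d * (s + v i) + P * D * v i = 0.
    apply: (mulfI s0); rewrite mulr0 -[RHS]bi QE; ring.
  have hv : (d * (s + v i) + P * D * v i) * v i = 0 by rewrite h mul0r.
  have : d * (s * v i) <= d * v i ^+ 2.
    have := mulr_ge0 lo (sqr_ge0 (v i)); move: hv; lra.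
  by rewrite ler_pM2l.
have others j : j != i -> v j = 0.
  move=> ji; have : \sum_(k | k != i) v k ^+ 2 <= 0.
    by move: s_le; rewrite -QE /Q (bigD1 i) //=; lra.
  move=> sum_le0; apply/eqP; rewrite -sqrf_eq0 eq_le sqr_ge0 andbT.
  apply: le_trans sum_le0; rewrite (bigD1 j) //= lerDl.
  by apply: sumr_ge0 => k _; rewrite sqr_ge0.
move=> j ji; apply/eqP; rewrite eq_le p_ge0 andbT leNgt; apply/negP => pj.
by move: s_v; rewrite -(v_eq j pj) (others j ji) mulr0 ltxx.
Qed.

End JacobianForm.

End QuadraticForm.

(** * Marginal costs on one resource *)

Lemma sum_le0_eq0 (R : realType) (I : finType) (x : I -> R) :
  (forall j, 0 <= x j) -> \sum_j x j <= 0 -> forall j, x j = 0.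
Proof.
move=> x0 sum0 j; apply/eqP; rewrite eq_le x0 andbT (le_trans _ sum0) //.
by rewrite (bigD1 j) //= lerDl sumr_ge0.
Qed.

Section Resource.
Variables (R : realType) (n : nat).
Hypothesis n_ge2 : (2 <= n)%N.
Implicit Types (c : R -> R) (x y p : 'I_n -> R).

Definition marginal c x i : R :=
  c (\sum_j x j) + x i * deriv_Rplus c (\sum_j x j).

Lemma mc_increasing c : classDmcsi c -> forall a b : R, 0 <= a -> a < b ->
  c a + a * deriv_Rplus c a < c b + b * deriv_Rplus c b.
Proof.
move=> [_ mc] a b a0 ab; apply: (mc a b true false) => //.
- by rewrite in_itv /= lexx ltW.
- by rewrite in_itv /= lexx ltW.
Qed.

(** If c'(X) = 0, the strictly increasing derivative c(x) + x c'(x) of x c(x)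
takes the value c(X) at X, so that X c(X) - Y c(Y) < c(X) (X - Y) for
0 < Y < X.  This says c(X) < c(Y), whereas c is nondecreasing. *)
Lemma mcsi_deriv_gt0 c X : classDmcsi c -> 0 < X -> 0 < deriv_Rplus c X.
Proof.
move=> cmc X0; have [[[dc _ _] c'0 _] _] := cmc.
rewrite lt_neqAle c'0 ?ltW // andbT; apply/negP => /eqP c'X.
pose Y := X / 2; pose s := X / 2.
have YX : Y + s = X by rewrite /Y /s; field.
have Y0 : 0 < Y by rewrite divr_gt0.
have s0 : 0 < s by rewrite divr_gt0.
have Ys : 0 < Y + (Y + s) by rewrite YX addr_gt0.
have YS0 : 0 <= Y + s by rewrite YX ltW.
(* the mean value theorem for c, and below for x c(x) *)
have [t [_ Z0]] := line_mvt 1 0 0 dc dc (ltW Y0) YS0 Ys.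
rewrite YX !mul1r !mul0r !mulr0 !addr0 !mul0r !addr0 => cE.
have c_le : c Y <= c X.
  by rewrite -subr_ge0 cE mulr_ge0 ?c'0 // ltW.
have [u [/andP[u0 u1] W0]] := line_mvt 0 Y s dc dc (ltW Y0) YS0 Ys.
rewrite YX !mul0r !add0r => xcE.
have := mc_increasing cmc (ltW W0); move=> /(_ X); rewrite -c'X mulr0 addr0.
have W_lt : Y + u * s < X by rewrite -YX ltrD2l -[ltRHS]mul1r ltr_pM2r.
move=> /(_ W_lt) mc_lt.
have : X * c X - Y * c Y < s * c X.
  by rewrite xcE; move: mc_lt; rewrite -(ltr_pM2l s0); lra.
have -> : X * c X - Y * c Y = s * c X + Y * (c X - c Y).
  by rewrite (_ : s = X - Y) ?/s ?/Y; [ring|field].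
by rewrite gtrDl ltNge mulr_ge0 // ?subr_ge0 // ltW.
Qed.

Section Segment.
Variables (c : R -> R) (x y : 'I_n -> R).
Hypothesis c_D : classD c.
Hypotheses (x_ge0 : forall j, 0 <= x j) (y_ge0 : forall j, 0 <= y j).
Hypothesis load_gt0 : 0 < \sum_j y j + \sum_j x j.
Let v j := x j - y j.

Definition on_segment (t : R) j := y j + t * (x j - y j).

Lemma sum_on_segment t :
  \sum_j on_segment t j = \sum_j y j + t * \sum_j v j.
Proof. by rewrite mulr_sumr -big_split. Qed.

Lemma on_segment_ge0 t j : 0 < t < 1 -> 0 <= on_segment t j.
Proof.
move=> /andP[t0 t1]; rewrite /on_segment.
have -> : y j + t * (x j - y j) = (1 - t) * y j + t * x j by ring.
by rewrite addr_ge0 // mulr_ge0 // ?subr_ge0 ltW.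
Qed.

Lemma on_segment_eq0 t j : 0 < t < 1 -> on_segment t j = 0 -> x j = 0 /\ y j = 0.
Proof.
move=> /andP[t0 t1]; rewrite /on_segment => h.
have h1 : 0 <= t * x j by rewrite mulr_ge0 // ltW.
have h2 : 0 <= (1 - t) * y j by rewrite mulr_ge0 // subr_ge0 ltW.
split; apply/eqP.
  have : t * x j == 0 by apply/eqP; lra.
  by rewrite mulf_eq0 gt_eqF.
have : (1 - t) * y j == 0 by apply/eqP; lra.
by rewrite mulf_eq0 gt_eqF // subr_gt0.
Qed.

Let sum_v : \sum_j y j + \sum_j v j = \sum_j x j.
Proof. by rewrite -big_split; apply: eq_bigr => j _; rewrite /v /=; ring. Qed.

Lemma marginal_mvt : exists2 t, 0 < t < 1 &
  let p := on_segment t in let X := \sum_j p j in 0 < X /\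
  \sum_i (marginal c x i - marginal c y i) * v i
  = jacobian_form v p (deriv_Rplus c X) (deriv2_Rplus c X).
Proof.
have [[dc dc' _] _ _] := c_D.
pose A := \sum_j v j * y j; pose B := \sum_j v j ^+ 2.
have Y0 : 0 <= \sum_j y j by exact: sumr_ge0.
have [||t [t01 X0 E]] := line_mvt (s := \sum_j v j) (\sum_j v j) A B dc dc' Y0.
- by rewrite sum_v sumr_ge0.
- by rewrite sum_v.
exists t => //=; rewrite sum_on_segment; split => //.
rewrite sum_v in E.
have AB : A + B = \sum_j v j * x j.
  by rewrite /A /B -big_split; apply: eq_bigr => j _; rewrite /v /=; ring.
have -> : \sum_i (marginal c x i - marginal c y i) * v i
   = \sum_j v j * c (\sum_j x j) + (A + B) * deriv_Rplus c (\sum_j x j)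
     - (\sum_j v j * c (\sum_j y j) + A * deriv_Rplus c (\sum_j y j)).
  rewrite AB /A !mulr_suml -!big_split -sumrB /=.
  by apply: eq_bigr => i _; rewrite /marginal; ring.
rewrite -!mulr_suml E.
have pvE : \sum_j on_segment t j * v j = A + t * B.
  rewrite /A /B mulr_sumr -big_split; apply: eq_bigr => j _.
  by rewrite /on_segment -/(v j) /=; ring.
by rewrite /jacobian_form -/(deriv2_Rplus c _) pvE /B; ring.
Qed.

Lemma own_cost_mvt i : (forall j, j != i -> x j = y j) -> exists2 t, 0 < t < 1 &
  c (\sum_j x j) * x i - c (\sum_j y j) * y i
  = marginal c (on_segment t) i * (x i - y i).
Proof.
move=> xy; have [[dc dc' _] _ _] := c_D.
have Y0 : 0 <= \sum_j y j by exact: sumr_ge0.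
have [||t [t01 X0 E]] := line_mvt (s := \sum_j v j) 0 (y i) (v i) dc dc Y0.
- by rewrite sum_v sumr_ge0.
- by rewrite sum_v.
exists t => //; rewrite sum_v in E.
have sE : \sum_j v j = v i.
  by rewrite (bigD1 i) //= big1 ?addr0 // => j /xy; rewrite /v => ->; rewrite subrr.
have yv : y i + v i = x i by rewrite /v; ring.
rewrite /marginal sum_on_segment /on_segment -/(v i).
move: E; rewrite yv !mul0r !add0r [x i * _]mulrC [y i * c _]mulrC => ->.
rewrite sE; ring.
Qed.

End Segment.

Lemma marginal_monotone c x y : classQ n c ->
  (forall j, 0 <= x j) -> (forall j, 0 <= y j) ->
  0 <= \sum_i (marginal c x i - marginal c y i) * (x i - y i).
Proof.
move=> [cD cQ] x0 y0; have [_ c'0 c''0] := cD.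
have [load0|load0] := ltP 0 (\sum_j y j + \sum_j x j).
  have [t t01 /= [X0 ->]] := marginal_mvt cD x0 y0 load0.
  apply: (jacobian_form_ge0 n_ge2) => //; last 3 first.
  - exact/c'0/ltW.
  - exact/c''0/ltW.
  - exact/cQ/ltW.
  by move=> j; exact: on_segment_ge0.
have X0 : 0 <= \sum_j x j by exact: sumr_ge0.
have Y0 : 0 <= \sum_j y j by exact: sumr_ge0.
apply: sumr_ge0 => i _; rewrite (sum_le0_eq0 x0) ?(sum_le0_eq0 y0); lra.
Qed.

(** Equality in [marginal_monotone]: the Jacobian form vanishes at an interior
point of the segment, so that [jacobian_form_eq0] applies.  A player with zero
flow there has zero flow at both ends, which is why a single user of the
resource at that point is the single user in x and in y. *)
Lemma marginal_strict c x y : classQ n c -> classDmcsi c ->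
  (forall j, 0 <= x j) -> (forall j, 0 <= y j) ->
  \sum_i (marginal c x i - marginal c y i) * (x i - y i) = 0 ->
  forall i, x i = y i.
Proof.
move=> [cD cQ] cmc x0 y0 E; have [_ c'0 c''0] := cD.
have [load0|load0] := ltP 0 (\sum_j y j + \sum_j x j); last first.
  have X0 : 0 <= \sum_j x j by exact: sumr_ge0.
  have Y0 : 0 <= \sum_j y j by exact: sumr_ge0.
  by move=> i; rewrite (sum_le0_eq0 x0) ?(sum_le0_eq0 y0) //; lra.
have [t t01 /= [X0 form]] := marginal_mvt cD x0 y0 load0.
have p0 j := on_segment_ge0 x0 y0 j t01.
have supp j := on_segment_eq0 x0 y0 t01 (j := j).
have v_supp j : on_segment x y t j = 0 -> x j - y j = 0.
  by move=> /supp[-> ->]; rewrite subrr.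
have [same|[i single]] := jacobian_form_eq0 n_ge2 p0 X0 (c'0 _ (ltW X0))
  (c''0 _ (ltW X0)) (cQ _ (ltW X0)) (mcsi_deriv_gt0 cmc X0) v_supp
  (etrans (esym form) E).
  by move=> j; apply/eqP; rewrite -subr_eq0 same.
have xi : \sum_j x j = x i.
  by rewrite (bigD1 i) //= big1 ?addr0 // => j /single/supp[].
have yi : \sum_j y j = y i.
  by rewrite (bigD1 i) //= big1 ?addr0 // => j /single/supp[].
have Ei : (marginal c x i - marginal c y i) * (x i - y i) = 0.
  rewrite -[RHS]E (bigD1 i) //= big1 ?addr0 // => j /single/supp[-> ->].
  by rewrite subrr mulr0.
move=> j; have [->|/single/supp[-> ->]//] := eqVneq j i.
move: Ei => /eqP; rewrite mulf_eq0 !subr_eq0 => /orP[|/eqP//].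
rewrite /marginal xi yi; case: (ltgtP (x i) (y i)) => // h /eqP me.
- by have := mc_increasing cmc (x0 i) h; rewrite me ltxx.
- by have := mc_increasing cmc (y0 i) h; rewrite me ltxx.
Qed.

(** The gradient inequality for the convex function t |-> c(t + t') t, where t'
is the flow of the other players.  Its derivative is the marginal cost of
player i, whose monotonicity is the case of [marginal_monotone] in which only
player i moves. *)
Lemma own_cost_convex c x y i : classQ n c ->
  (forall j, 0 <= x j) -> (forall j, 0 <= y j) -> (forall j, j != i -> x j = y j) ->
  c (\sum_j x j) * x i - c (\sum_j y j) * y i <= marginal c x i * (x i - y i).
Proof.
move=> cQ x0 y0 xy; have [cD _] := cQ.
have [load0|load0] := ltP 0 (\sum_j y j + \sum_j x j); last first.
  have X0 : 0 <= \sum_j x j by exact: sumr_ge0.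
  have Y0 : 0 <= \sum_j y j by exact: sumr_ge0.
  rewrite (sum_le0_eq0 x0) ?(sum_le0_eq0 y0); lra.
have [t t01 ->] := own_cost_mvt cD x0 y0 load0 xy.
have p0 j := on_segment_ge0 x0 y0 j t01.
have := marginal_monotone cQ x0 p0.
rewrite (bigD1 i) //= big1 => [|j /xy xyj]; last first.
  by rewrite /on_segment xyj subrr mulr0 addr0 subrr mulr0.
have /andP[_ t1] := t01.
have -> : x i - on_segment x y t i = (1 - t) * (x i - y i) by rewrite /on_segment; ring.
rewrite addr0 mulrCA pmulr_rge0 ?subr_gt0 //; lra.
Qed.

End Resource.

(** * Equilibria as solutions of a variational inequality *)

Section Game.
Variables (R : realType) (n : nat) (E : finType) (G : splittable_game R n E).
Hypothesis n_ge2 : (2 <= n)%N.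
Hypothesis cost_class : forall e, classQ n (cost G e) /\ classDmcsi (cost G e).
Local Notation profile := ('I_n -> E -> R).
Implicit Types (x y z w : profile).
Local Notation K := (profiles G).

Definition pseudogradient x : profile :=
  fun i e => marginal (cost G e) (x^~ e) i.

Definition pairing x w : R := \sum_i \sum_e pseudogradient x i e * w i e.

Lemma pairingZ x w a : pairing x (a *: w) = a * pairing x w.
Proof.
rewrite /pairing mulr_sumr; apply: eq_bigr => j _; rewrite mulr_sumr.
by apply: eq_bigr => e _; rewrite mulrCA.
Qed.

Lemma pairingBC x y z : pairing x (y - z) = - pairing x (z - y).
Proof. by rewrite -opprB -scaleN1r pairingZ mulN1r. Qed.

Definition toward x z (t : R) : profile := fun i e => x i e + t * (z i e - x i e).

Lemma towardB x z t : toward x z t - x = t *: (z - x).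
Proof.
apply/funext => i; apply/funext => e.
by change (x i e + t * (z i e - x i e) - x i e = t * (z i e - x i e)); ring.
Qed.

Definition variational_solution x := forall z, K z -> 0 <= pairing x (z - x).

Lemma profile_ge0 x e : K x -> forall j, 0 <= x j e.
Proof. by move=> Kx j; exact: strategies_ge0 (Kx j) e. Qed.

Lemma toward_strategy i (a b : E -> R) t : 0 <= t <= 1 ->
  strategies G i a -> strategies G i b ->
  strategies G i (fun e => a e + t * (b e - a e)).
Proof.
move=> /andP[t0 t1] Ka Kb.
have /set_mem := strategies_convex (Itv01 t0 t1) (mem_set Kb) (mem_set Ka).
congr (strategies G i _); apply/funext => e.
change (t * b e + (1 - t) * a e = a e + t * (b e - a e)); ring.
Qed.

Lemma toward_profile x z t : 0 <= t <= 1 -> K x -> K z -> K (toward x z t).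
Proof. by move=> t01 Kx Kz i; exact: toward_strategy (Kx i) (Kz i). Qed.

(** Continuity of F along segments, in the form in which it is used twice: to
pass from Minty's inequality to the variational one, and from the costs of
small deviations to the first-order condition of an equilibrium. *)
Lemma pairing_hemicontinuous x z w : K x -> K z ->
  (forall t, 0 < t <= 1 -> 0 <= pairing (toward x z t) w) -> 0 <= pairing x w.
Proof.
move=> Kx Kz pos.
pose S e := \sum_j x j e; pose D e := \sum_j (z j e - x j e).
(* f is the pairing for 0 <= t <= 1, and clamping makes it continuous on R *)
pose f t := \sum_i \sum_e (clamp (cost G e) (S e + t * D e)
  + (x i e + t * (z i e - x i e)) * clamp (deriv_Rplus (cost G e)) (S e + t * D e))
  * w i e.
have loadE (t : R) e : \sum_j toward x z t j e = S e + t * D e.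
  by rewrite /S /D mulr_sumr -big_split.
have fE (t : R) : 0 <= t <= 1 -> f t = pairing (toward x z t) w.
  move=> t01; apply: eq_bigr => i _; apply: eq_bigr => e _.
  have load_ge0 : 0 <= S e + t * D e.
    rewrite -loadE; apply: sumr_ge0 => j _.
    exact: profile_ge0 (toward_profile t01 Kx Kz) j.
  by rewrite /pseudogradient /marginal loadE !clampE.
have f_cont : continuous f.
  apply: continuous_big => [|i _]; first exact: add_continuous.
  apply: continuous_big => [|e _]; first exact: add_continuous.
  have [[dc dc' _] _ _] := cost_classD G e.
  move=> t; apply: cvgM; last exact: cvg_cst.
  apply: cvgD; first exact: clamp_affine_continuous.
  apply: cvgM; first exact: continuous_affine.
  exact: clamp_affine_continuous.
have toward0 : toward x z 0 = x.
  by apply/funext => i; apply/funext => e; rewrite /toward mul0r addr0.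
rewrite -toward0 -fE ?lexx ?ler01 //; apply: continuous_ge0_at0 => // t t01.
by rewrite fE ?pos //; case/andP: t01 => /ltW -> ->.
Qed.

Lemma pairing_monotone x y : K x -> K y ->
  0 <= pairing x (x - y) - pairing y (x - y).
Proof.
move=> Kx Ky; rewrite -sumrB.
under eq_bigr do rewrite -sumrB.
rewrite exchange_big sumr_ge0 //= => e _.
under eq_bigr do rewrite -mulrBl.
by apply: (marginal_monotone n_ge2 (cost_class e).1); exact: profile_ge0.
Qed.

Lemma pairing_strict x y : K x -> K y ->
  pairing x (x - y) - pairing y (x - y) <= 0 -> x = y.
Proof.
move=> Kx Ky; rewrite -sumrB.
under eq_bigr do rewrite -sumrB.
rewrite exchange_big /= => le0; apply/funext => i; apply/funext => e.
apply: (marginal_strict n_ge2 (cost_class e).1 (cost_class e).2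
  (profile_ge0 e Kx) (profile_ge0 e Ky)).
have := sum_le0_eq0 _ le0 e; under eq_bigr do rewrite -mulrBl; apply.
move=> e'; under eq_bigr do rewrite -mulrBl.
by apply: (marginal_monotone n_ge2 (cost_class e').1); exact: profile_ge0.
Qed.

Lemma own_term_only i x y w : (forall j, j != i -> y j = x j) ->
  pairing w (y - x) = \sum_e pseudogradient w i e * (y i e - x i e).
Proof.
move=> yx; rewrite /pairing (bigD1 i) //= [X in _ + X]big1 ?addr0 // => j /yx yxj.
apply: big1 => e _; rewrite (_ : (y - x) j e = y j e - x j e) //.
by rewrite yxj subrr mulr0.
Qed.

Lemma private_cost_convex i x y : K x -> K y -> (forall j, j != i -> y j = x j) ->
  private_cost G i y - private_cost G i x <= pairing y (y - x).
Proof.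
move=> Kx Ky yx; rewrite (own_term_only _ yx) -sumrB; apply: ler_sum => e _.
apply: (own_cost_convex n_ge2 (cost_class e).1) => [j|j|j ji].
- exact: profile_ge0.
- exact: profile_ge0.
- by rewrite yx.
Qed.

Definition deviate x i (a : E -> R) : profile := [eta x with i |-> a].

Lemma deviation_profile i x a : K x -> strategies G i a -> K (deviate x i a).
Proof. by move=> Kx Ka j; rewrite /deviate /=; case: eqVneq => [->|]. Qed.

(** The pairing of F x with z - x is the sum over i of its pairings with the
deviations of player i alone to z i.  If x is an equilibrium, a deviation of
length t costs something nonnegative, and by convexity at most its pairing with
F at the deviated profile; dividing by t and letting t tend to 0 gives the
inequality.  The converse is the convexity of the own cost at x. *)
Lemma is_nashP x : is_nash G x <-> K x /\ variational_solution x.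
Proof.
split=> [[Kx nash]|[Kx vi]]; split => //.
- move=> z Kz.
  suff own i : 0 <= pairing x (deviate x i (z i) - x).
    rewrite (_ : pairing x (z - x) = \sum_i pairing x (deviate x i (z i) - x)).
      by apply: sumr_ge0 => i _.
    apply: eq_bigr => i _; rewrite (own_term_only (i := i)) /deviate /= ?eqxx // => j.
    by move=> /negbTE ->.
  pose d := deviate x i (z i).
  have Kd : K d by exact: deviation_profile.
  apply: (pairing_hemicontinuous Kx Kd) => t /andP[t0 t1].
  have t01 : 0 <= t <= 1 by rewrite ltW.
  have Kt := toward_profile t01 Kx Kd.
  have tx j : j != i -> toward x d t j = x j.
    move=> /negbTE ji; apply/funext => e.
    by rewrite /toward /d /deviate /= ji subrr mulr0 addr0.
  have cost_le : private_cost G i x <= private_cost G i (deviate x i _) :=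
    nash i _ (Kt i).
  have dev : deviate x i (toward x d t i) = toward x d t.
    by apply/funext => j; rewrite /deviate /=; case: eqVneq => [->|/tx].
  rewrite dev -subr_ge0 in cost_le.
  have := le_trans cost_le (private_cost_convex Kx Kt tx).
  by rewrite towardB pairingZ pmulr_rge0.
- move=> i a Ka; rewrite -/(deviate x i a); set d := deviate x i a.
  have Kd : K d by exact: deviation_profile.
  have dx j : j != i -> x j = d j by rewrite /d /deviate /= => /negbTE ->.
  have := private_cost_convex Kd Kx dx; have := vi d Kd.
  by rewrite (pairingBC x x d); lra.
Qed.

Lemma pairing_continuous (T : topologicalType) (h : T -> profile) y z :
  (forall i e, continuous (fun u : T => h u i e : R)) ->
  continuous (fun u : T => pairing y (z - h u)).
Proof.
move=> h_cont; apply: continuous_big => [|i _]; first exact: add_continuous.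
apply: continuous_big => [|e _]; first exact: add_continuous.
move=> u; apply: (cvgMl_tmp (g := fun u : T => z i e - h u i e)).
exact: (cvgB (cvg_cst (z i e)) (h_cont i e u)).
Qed.

Lemma nash_exists : exists x, is_nash G x.
Proof.
pose T := prod_topology (fun _ : 'I_n => {ptws E -> R}).
pose b (y x : T) : R := pairing y ((y : profile) - x).
have K_compact : @compact T K.
  exact: (@tychonoff _ (fun _ : 'I_n => {ptws E -> R}) (strategies G)
    (@strategies_compact R n E G)).
have K_nonempty : K !=set0.
  have [x Kx] := choice (fun i => strategies_nonempty G i).
  by exists x.
have b_cont y : continuous (b y).
  apply: pairing_continuous => i e x.
  apply: (@continuous_comp _ _ _ (proj i : T -> {ptws E -> R})
    (proj e : {ptws E -> R} -> R)).
    exact: (@proj_continuous _ (fun _ : 'I_n => {ptws E -> R})).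
  exact: (@proj_continuous _ (fun _ : E => R)).
(* x satisfies the inequality with F at the other end of each segment *)
have [||x Kx minty] := minty_inequality (T := T) K_compact K_nonempty b_cont.
- move=> x z t Kx Kz /andP[t0 t1]; exists (toward x z t).
    by apply: toward_profile => //; rewrite ltW.
  move=> y; rewrite /b /pairing -sumrB mulr_sumr -big_split; apply: eq_bigr => i _ /=.
  rewrite -sumrB mulr_sumr -big_split; apply: eq_bigr => e _ /=.
  have subE (u v : profile) : (u - v) i e = u i e - v i e by [].
  rewrite !subE /toward; ring.
- move=> x y Kx Ky; have := pairing_monotone Kx Ky; rewrite /b.
  by rewrite (pairingBC y x y) opprK.
exists x; apply/is_nashP; split => // z Kz.
apply: (pairing_hemicontinuous Kx Kz) => t /andP[t0 t1].
have t01 : 0 <= t <= 1 by rewrite ltW.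
have := minty _ (toward_profile t01 Kx Kz).
by rewrite /b towardB pairingZ pmulr_rge0.
Qed.

End Game.

Theorem corollary2 (R : realType) (n : nat) (hn : (2 <= n)%N) (E : finType)
    (G : splittable_game R n E)
    (hc : forall e : E, classQ n (cost G e) /\ classDmcsi (cost G e)) :
  exists! x : 'I_n -> E -> R, is_nash G x.
Proof.
have [x nash_x] := nash_exists hn hc; exists x; split => // y nash_y.
have /(is_nashP hn hc)[Kx vx] := nash_x; have /(is_nashP hn hc)[Ky vy] := nash_y.
apply: (pairing_strict hn hc Kx Ky).
have := vx y Ky; have := vy x Kx.
by rewrite (pairingBC G x y x); lra.
Qed.
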